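(* Let $V:=p^{\eta}\operatorname{Id}-p^{\nu}\operatorname{Id}+\operatorname{Id}-A$ and let $F_1,F_2\colon I^2\to I$ and $G\colon I\to I^2$ be the maps $$F_1(y_1,y_2):=p^{\eta}y_1-Vy_2,\qquad F_2(y_1,y_2):=P(A)(y_1-y_2)+Q(A)y_2,\qquad G(y):=(Vy,p^{\eta}y).$$ Then the map $F$ defined on $\ker(F_1)\cap\ker(F_2)$ by $F(f_0,\gamma):=(\alpha_1(\gamma),f_{f_0,\gamma})$ induces a linear isomorphism $$\frac{\ker(F_1)\cap\ker(F_2)}{\operatorname{Im}(G)}\simeq\operatorname{H}^2_{\diamond}(H,I).$$
   Context: Let $p$ be a prime and $\nu,\eta$ integers with $0<\nu\le\eta\le2\nu$; assume $p$ is odd, or $p=2$ and $(\nu,\eta)\ne(1,2)$. Let $H=\mathbb{Z}/p^{\eta}\mathbb{Z}$ with its usual sum, the operation $i\cdot j:=(1-p^{\nu}i)j$ (a linear cycle set) and the operation $i\times j:=i+j+p^{\nu}ij$. Then $(H,\times)$ is a cyclic group with neutral element $0$ generated by $1$; $1^{\times k}=k+\binom{k}{2}p^{\nu}$ is the $k$-th power of $1$ in it. Let $I$ be an abelian group and $\diamond\colon H\times I\to I$ a map with $(h'\times h)\diamond y=h\diamond(h'\diamond y)$, $h\diamond(y+y')=h\diamond y+h\diamond y'$, $0\diamond y=y$. Let $A\in\operatorname{End}(I)$, $Ay:=1\diamond y$; then $A^{p^{\eta}}=\operatorname{Id}$ and $1^{\times k}\diamond y=A^{k}y$. A 2-cocycle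 is a pair $(\beta,f)$ of maps $H\times H\to I$, both vanishing when some argument is $0$, with $\beta$ symmetric, such that for all $a,b,c\in H$: $\beta(b,c)-\beta(a+b,c)+\beta(a,b+c)-\beta(a,b)=0$; $f(a,b+c)-f(a,b)-f(a,c)=a\diamond\beta(b,c)-\beta(a\cdot b,a\cdot c)$; $f(a+b,c)=(a\cdot b)\diamond f(a,c)+f(a\cdot b,a\cdot c)$. It is a 2-coboundary if there is $t\colon H\to I$ with $t(0)=0$, $\beta(a,b)=t(a)-t(a+b)+t(b)$ and $f(a,b)=t(a\cdot b)-a\diamond t(b)$. $\operatorname{H}^2_\diamond(H,I)$ is the group of 2-cocycles modulo 2-coboundaries. For $\gamma\in I$ and integers $0\le i,j<p^{\eta}$, $\alpha_1(\gamma)(i,j):=\gamma$ if $i+j\ge p^{\eta}$ and $0$ otherwise (a map $H\times H\to I$). For $(f_0,\gamma)\in I^2$ with $p^{\eta}f_0=V\gamma$: put $\Gamma(\gamma,b):=A\alpha_1(\gamma)(b,1)-\alpha_1(\gamma)(1\cdot b,1\cdot1)$; the map $\hat f(h):=hf_0+\sum_{b=0}^{h-1}\Gamma(\gamma,b)$ ($h\in\mathbb{N}_0$) is $p^{\eta}$-periodic and induces $\tilde f\colon H\to I$; define $f_{f_0,\gamma}\colon H\times H\to I$ by $f_{f_0,\gamma}(1^{\times k},c):=\sum_{j=0}^{k-1}A^{k-1-j}\tilde f(j\cdot c)$ for $0\le k<p^{\eta}$, $c\in H$. $P(X):=\sum_{j=0}^{p^{\eta}-1}(jp^{\nu}+1)X^{j}$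 and $Q(X):=\sum_{j=0}^{p^{\eta}-1}jp^{2\nu-\eta}X^{j}+p^{\nu}$. *)

(* Defs.v *)
From HB Require Import structures.
From mathcomp Require Import all_boot all_order all_algebra.
From mathcomp Require Import boolp.
Set Implicit Arguments.
Unset Strict Implicit.
Unset Printing Implicit Defensive.

Import GRing.Theory.
Local Open Scope ring_scope.

Section LinearCycleSet.

Variables p nu eta : nat.

(* 'Z_n is Z/nZ only for 1 < n, which holds for n = p ^ eta when p is prime
   and 0 < eta. *)
Local Notation H := 'Z_(p ^ eta).

Definition cdot (i j : H) : H := (1 - (p ^ nu)%:R * i) * j.

Definition ctimes (i j : H) : H := i + j + (p ^ nu)%:R * i * j.

Definition tpow (k : nat) : H := iter k (ctimes 1) 0.

(* Discrete logarithm to the base 1 in (H, ctimes): the least k with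
   tpow k = a. It is smaller than p ^ eta when 1 generates (H, ctimes). *)
Definition tlog (a : H) : nat := index a (mkseq tpow (p ^ eta)).

Record diamond_action (I : zmodType) := DiamondAction {
  act :> H -> I -> I;
  actM : forall h' h y, act (ctimes h' h) y = act h' (act h y);
  actD : forall h y y', act h (y + y') = act h y + act h y';
  act0 : forall y, act 0 y = y
}.

End LinearCycleSet.

Section SubtractionInterchange.

Variable I : zmodType.

Lemma addrBAC (a b c d : I) : (a + b) - (c + d) = (a - c) + (b - d).
Proof. by rewrite opprD addrACA. Qed.

Lemma subrBAC (a b c d : I) : (a - b) - (c - d) = (a - c) - (b - d).
Proof. by rewrite addrBAC [in RHS]opprD. Qed.

End SubtractionInterchange.

Section PolynomialEvaluation.

Variable I : zmodType.

(* q(A), for q an integral polynomial and A an endomorphism of I. *)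
Definition eval_end (q : {poly int}) (A : I -> I) (y : I) : I :=
  \sum_(j < size q) iter j A y *~ q`_j.

Lemma eval_end_zmod_morphism q (A : {additive I -> I}) :
  zmod_morphism (eval_end q A).
Proof.
move=> x y; rewrite /eval_end -sumrB; apply: eq_bigr => j _.
rewrite -mulrzBl; congr (_ *~ _).
by elim: (nat_of_ord j) => //= k ->; rewrite raddfB.
Qed.

HB.instance Definition _ q (A : {additive I -> I}) :=
  GRing.isZmodMorphism.Build I I (eval_end q A) (eval_end_zmod_morphism q A).

End PolynomialEvaluation.

Section Cohomology.

Variables (p nu eta : nat) (I : zmodType) (dia : diamond_action p nu eta I).
Local Notation H := 'Z_(p ^ eta).
Local Notation cdot := (@cdot p nu eta).

Lemma act_zmod_morphism (h : H) : zmod_morphism (dia h).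
Proof.
move=> x y; apply: (addIr (dia h y)).
by rewrite subrK -actD subrK.
Qed.

HB.instance Definition _ (h : H) :=
  GRing.isZmodMorphism.Build I I (act dia h) (act_zmod_morphism h).

Definition A (y : I) : I := dia 1 y.

HB.instance Definition _ :=
  GRing.isZmodMorphism.Build I I A (act_zmod_morphism 1).

(* Pairs (beta, f) of maps H x H -> I. *)
Definition cochain : zmodType :=
  ({ffun H * H -> I} * {ffun H * H -> I})%type.

Record is_cocycle (z : cochain) : Prop := IsCocycle {
  cocycle_beta0 : forall a, z.1 (a, 0) = 0 /\ z.1 (0, a) = 0;
  cocycle_f0 : forall a, z.2 (a, 0) = 0 /\ z.2 (0, a) = 0;
  cocycle_sym : forall a b, z.1 (a, b) = z.1 (b, a);
  cocycle_beta : forall a b c,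
    z.1 (b, c) - z.1 (a + b, c) + z.1 (a, b + c) - z.1 (a, b) = 0;
  cocycle_beta_f : forall a b c,
    z.2 (a, b + c) - z.2 (a, b) - z.2 (a, c) =
    dia a (z.1 (b, c)) - z.1 (cdot a b, cdot a c);
  cocycle_f : forall a b c,
    z.2 (a + b, c) = dia (cdot a b) (z.2 (a, c)) + z.2 (cdot a b, cdot a c)
}.

Definition cocycle_pred : {pred cochain} := fun z => `[< is_cocycle z >].

Lemma cocycle_zmod_closed : zmod_closed cocycle_pred.
Proof.
split=> [|x y /asboolP [x1 x2 x3 x4 x5 x6] /asboolP [y1 y2 y3 y4 y5 y6]];
  apply/asboolP.
  by split=> *; rewrite ?ffunE ?raddf0 ?subrr ?addr0.
have E1 u : (x - y).1 u = x.1 u - y.1 u by rewrite !ffunE.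
have E2 u : (x - y).2 u = x.2 u - y.2 u by rewrite !ffunE.
split=> *; rewrite ?(E1, E2).
- by rewrite !(x1 _).1 !(x1 _).2 !(y1 _).1 !(y1 _).2 subrr.
- by rewrite !(x2 _).1 !(x2 _).2 !(y2 _).1 !(y2 _).2 subrr.
- by rewrite x3 y3.
- by rewrite [X in X + _ - _]subrBAC -addrBAC subrBAC x4 y4 subrr.
- rewrite act_zmod_morphism [X in X - _ = _]subrBAC [LHS]subrBAC x5 y5.
  by rewrite subrBAC.
- by rewrite act_zmod_morphism x6 y6 addrBAC.
Qed.

HB.instance Definition _ :=
  GRing.isZmodClosed.Build cochain cocycle_pred cocycle_zmod_closed.

Record cocycle := Cocycle {
  cocycle_val :> cochain;
  cocycleP : cocycle_val \in cocycle_pred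
}.

HB.instance Definition _ := [isSub for cocycle_val].
HB.instance Definition _ := [Choice of cocycle by <:].
HB.instance Definition _ := [SubChoice_isSubZmodule of cocycle by <:].

Definition is_coboundary (z : cocycle) : Prop :=
  exists t : H -> I,
    [/\ t 0 = 0,
        forall a b, (val z).1 (a, b) = t a - t (a + b) + t b
      & forall a b, (val z).2 (a, b) = t (cdot a b) - dia a (t b)].

Definition coboundary_pred : {pred cocycle} := fun z => `[< is_coboundary z >].

Lemma coboundary_zmod_closed : zmod_closed coboundary_pred.
Proof.
split=> [|x y /asboolP [t [t1 t2 t3]] /asboolP [s [s1 s2 s3]]]; apply/asboolP.
  exists (fun=> 0); split=> // *; rewrite !ffunE ?raddf0 ?subr0 ?addr0 //.
exists (fun h => t h - s h); split=> [|a b|a b].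
- by rewrite t1 s1 subrr.
- by rewrite !ffunE t2 s2 addrBAC subrBAC.
- by rewrite !ffunE t3 s3 act_zmod_morphism subrBAC.
Qed.

HB.instance Definition _ :=
  GRing.isZmodClosed.Build cocycle coboundary_pred coboundary_zmod_closed.

Definition H2 : zmodType := Quotient.quot coboundary_pred.

Definition V (y : I) : I := y *+ p ^ eta - y *+ p ^ nu + y - A y.

Definition P : {poly int} :=
  \sum_(j < p ^ eta) ((j * p ^ nu + 1)%N%:Z *: 'X^j).

Definition Q : {poly int} :=
  \sum_(j < p ^ eta) ((j * p ^ (2 * nu - eta))%N%:Z *: 'X^j)
  + ((p ^ nu)%N%:Z)%:P.

Definition F1 (y : I * I) : I := y.1 *+ p ^ eta - V y.2.

Definition F2 (y : I * I) : I :=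
  eval_end P A (y.1 - y.2) + eval_end Q A y.2.

Definition G (y : I) : I * I := (V y, y *+ p ^ eta).

Lemma V_zmod_morphism : zmod_morphism V.
Proof.
move=> x y; rewrite /V (raddfB A) !mulrnBl.
by rewrite [X in X + _ - _]subrBAC -addrBAC subrBAC.
Qed.

HB.instance Definition _ := GRing.isZmodMorphism.Build I I V V_zmod_morphism.

Definition ker_pred : {pred I * I} := fun y => (F1 y == 0) && (F2 y == 0).

Lemma ker_zmod_closed : zmod_closed ker_pred.
Proof.
rewrite /ker_pred.
split=> [|x y /andP [/eqP x1 /eqP x2] /andP [/eqP y1 /eqP y2]].
  by rewrite unfold_in /F1 /F2 /= mul0rn !(raddf0, subrr, addr0) eqxx.
rewrite unfold_in; apply/andP; split; apply/eqP.
  rewrite /F1 /= (raddfB V) mulrnBl subrBAC.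
  by move: x1 y1; rewrite /F1 => -> ->; rewrite subrr.
rewrite /F2 /= subrBAC (eval_end_zmod_morphism _ _ (_ - _)).
rewrite [X in _ + X]eval_end_zmod_morphism -addrBAC.
by move: x2 y2; rewrite /F2 => -> ->; rewrite subrr.
Qed.

HB.instance Definition _ := GRing.isZmodClosed.Build _ ker_pred ker_zmod_closed.

Record kernel := Kernel {
  kernel_val :> I * I;
  kernelP : kernel_val \in ker_pred
}.

HB.instance Definition _ := [isSub for kernel_val].
HB.instance Definition _ := [Choice of kernel by <:].
HB.instance Definition _ := [SubChoice_isSubZmodule of kernel by <:].

Definition im_pred : {pred kernel} := fun x => `[< exists y, val x = G y >].

Lemma im_zmod_closed : zmod_closed im_pred.
Proof.
split=> [|x y /asboolP [u ux] /asboolP [v vy]]; apply/asboolP.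
  by exists 0; rewrite /G (raddf0 V) mul0rn raddf0.
have -> : val (x - y) = val x - val y by exact: raddfB.
by exists (u - v); rewrite ux vy /G (raddfB V) mulrnBl.
Qed.

HB.instance Definition _ :=
  GRing.isZmodClosed.Build kernel im_pred im_zmod_closed.

Definition ker_mod_im : zmodType := Quotient.quot im_pred.

Definition alpha1 (g : I) (i j : H) : I :=
  if (p ^ eta <= val i + val j)%N then g else 0.

Definition Gam (g : I) (b : nat) : I :=
  A (alpha1 g b%:R 1) - alpha1 g (cdot 1 b%:R) (cdot 1 1).

Definition fhat (f0 g : I) (h : nat) : I := f0 *+ h + \sum_(b < h) Gam g b.

Definition ftilde (f0 g : I) (h : H) : I := fhat f0 g (val h).

(* f_{f0, g}(a, c), where a = 1^{x k} with k = tlog a. *)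
Definition fcomp (f0 g : I) (a c : H) : I :=
  \sum_(j < tlog nu a) iter (tlog nu a - 1 - j) A (ftilde f0 g (cdot j%:R c)).

Definition F (y : I * I) : cochain :=
  ([ffun u => alpha1 y.2 u.1 u.2], [ffun u => fcomp y.1 y.2 u.1 u.2]).

End Cohomology.

(* Main.v *)
(** Write N = p^eta and q = p^nu, so that q^2 = 0 in H. Since
    a + b = a x (a . b), the third cocycle condition is the crossed rule
    f(a x b, c) = b <> f(a, c) + f(b, a . c), and as (H, x) is cyclic, f is
    determined by f(1, _); conversely f(1, _) extends to H x H iff
    S(c) = sum_{j < N} A^(N-1-j) f(1, j . c) vanishes for all c.
    Subtracting a coboundary makes beta = alpha1(gamma), and then the second
    condition determines f(1, _) from f0 = f(1, 1): with u = N + 1 - q,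
    f(1, h) = h f0 + floor(h / N) A gamma - floor(h u / N) gamma.
    N-periodicity of this expression is F1 (f0, gamma) = 0. The second
    condition makes S additive, so S = 0 iff S(1) = 0, and
    A S(1) = F2 (f0, gamma). A coboundary with beta = alpha1(gamma) comes from
    t(h) = h y with N y = gamma, and then f0 = V y, which gives Im(G). *)

From HB Require Import structures.
Require Import Defs.
From mathcomp Require Import all_boot all_order all_algebra.
From mathcomp Require Import boolp.
From mathcomp Require Import zify ring.

Set Implicit Arguments.
Unset Strict Implicit.
Unset Printing Implicit Defensive.

Import GRing.Theory.
Local Open Scope ring_scope.
Local Open Scope quotient_scope.

(** * Floors, binomial coefficients and sums *)

Lemma divnD_modr m n d : ((m + n %% d) %/ d + n %/ d = (m + n) %/ d)%N.
Proof.
case: d => [|d]; first by rewrite !divn0.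
by rewrite [in RHS](divn_eq n d.+1) addnCA divnMDl // addnC.
Qed.

Lemma divnD_mod m n d :
  ((m + n) %/ d = m %/ d + n %/ d + (m %% d + n %% d) %/ d)%N.
Proof.
rewrite -[LHS]divnD_modr [(m + _)%N]addnC -[((_ + m) %/ _)%N]divnD_modr.
by rewrite -addnA addnC [(n %% d + _)%N]addnC.
Qed.

Lemma bin2_add m n : ('C(m + n, 2) = 'C(m, 2) + 'C(n, 2) + m * n)%N.
Proof.
elim: n => [|n IH]; first by rewrite addn0 muln0 bin0n !addn0.
by rewrite addnS !binS IH !bin1; lia.
Qed.

Lemma double_bin2 n : (2 * 'C(n, 2) = n * n.-1)%N.
Proof. by rewrite -mul_bin_diag bin1. Qed.

Lemma telescope_sum_ord (U : zmodType) (f : nat -> U) n :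
  \sum_(i < n) (f i.+1 - f i) = f n - f 0%N.
Proof.
by rewrite -(big_mkord xpredT (fun i => f i.+1 - f i)) telescope_sumr.
Qed.

(** For [F2E]: turns an identity between multiplicities into one where [x *+ d - x] is ready to
    telescope. *)
Lemma mulrn_shift (U : zmodType) (x : U) n r m d : (n + r + 1 = m + d)%N ->
  x *- n = x *- m + (x *+ r - (x *+ d - x)).
Proof.
move=> /(congr1 (GRing.natmul x)); rewrite !mulrnDr mulr1n => e.
rewrite opprB [RHS](AC (1*(1*2)) ((1*4)*(2*3))) /= -opprD -e -addrA opprD.
by rewrite subrK.
Qed.

Section CycleSet.

Variables p nu eta : nat.
Hypotheses (hp : prime p) (hnu : (0 < nu)%N).
Hypotheses (hnueta : (nu <= eta)%N) (heta : (eta <= 2 * nu)%N).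

Local Notation N := (p ^ eta)%N.
Local Notation q := (p ^ nu)%N.
Local Notation H := 'Z_(p ^ eta).
Local Notation cdot := (@cdot p nu eta).
Local Notation ctimes := (@ctimes p nu eta).
Local Notation tpow := (@tpow p nu eta).
Local Notation tlog := (@tlog p nu eta).

(** * Representatives of residue classes modulo N *)

Lemma q_gt1 : (1 < q)%N.
Proof. by rewrite -(exp1n nu) ltn_exp2r // prime_gt1. Qed.

Lemma leq_qN : (q <= N)%N.
Proof. by rewrite leq_exp2l // prime_gt1. Qed.

Lemma N_gt1 : (1 < N)%N.
Proof. exact: leq_trans q_gt1 leq_qN. Qed.

Lemma N_gt0 : (0 < N)%N.
Proof. exact: ltnW N_gt1. Qed.

Lemma val_natH k : val (k%:R : H) = (k %% N)%N.
Proof. by rewrite -[RHS](val_Zp_nat N_gt1). Qed.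

Lemma natH_val (a : H) : (val a)%:R = a.
Proof. exact: natr_Zp. Qed.

Lemma ltn_valH (a : H) : (val a < N)%N.
Proof. by case: a => a /=; rewrite Zp_cast // N_gt1. Qed.

Lemma natH_mod k : (k %% N)%:R = k%:R :> H.
Proof. by apply: val_inj; rewrite !val_natH modn_mod. Qed.

Lemma natHN : N%:R = 0 :> H.
Proof. by rewrite -natH_mod modnn. Qed.

Lemma val_addH (a b : H) : val (a + b) = ((val a + val b) %% N)%N.
Proof. by rewrite -{1}(natH_val a) -{1}(natH_val b) -natrD val_natH. Qed.

Lemma natH_qq : (q%:R * q%:R : H) = 0.
Proof.
rewrite -natrM -expnD addnn -mul2n -(subnK heta) expnD natrM natHN.
exact: mulr0.
Qed.

(** * The operations of the cycle set and the powers of 1 *)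

Lemma cdot0r (a : H) : cdot a 0 = 0.
Proof. exact: mulr0. Qed.

Lemma cdot0l (a : H) : cdot 0 a = a.
Proof. by rewrite /cdot mulr0 subr0 mul1r. Qed.

Lemma cdotDr (a b c : H) : cdot a (b + c) = cdot a b + cdot a c.
Proof. exact: mulrDr. Qed.

(** As q^2 = 0, (1 - q a)(1 - q b) = 1 - q (a + b); for the same reason the extra term q a b of a x
    b disappears in [cdot_times]. *)
Lemma cdotDl (a b c : H) : cdot (a + b) c = cdot b (cdot a c).
Proof. by rewrite /cdot; ring: natH_qq. Qed.

Lemma cdot_times (a b c : H) : cdot (ctimes a b) c = cdot b (cdot a c).
Proof. by rewrite /cdot /ctimes; ring: natH_qq. Qed.

Lemma ctimes_cdot (a b : H) : ctimes a (cdot a b) = a + b.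
Proof. by rewrite /cdot /ctimes; ring: natH_qq. Qed.

Lemma ctimesC (a b : H) : ctimes a b = ctimes b a.
Proof. by rewrite /ctimes; ring. Qed.

Lemma ctimesA (a b c : H) : ctimes a (ctimes b c) = ctimes (ctimes a b) c.
Proof. by rewrite /ctimes; ring. Qed.

Lemma ctimes0 (a : H) : ctimes 0 a = a.
Proof. by rewrite /ctimes; ring. Qed.

Lemma tpowS k : tpow k.+1 = ctimes 1 (tpow k).
Proof. by []. Qed.

Lemma tpowD k l : tpow (k + l) = ctimes (tpow k) (tpow l).
Proof.
by elim: k => [|k IH]; rewrite ?ctimes0 // addSn !tpowS IH ctimesA.
Qed.

Lemma tpowE k : tpow k = (k + 'C(k, 2) * q)%:R.
Proof.
elim: k => // k IH.
have -> : (k.+1 + 'C(k.+1, 2) * q = 1 + (k + 'C(k, 2) * q) + q * k)%N.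
  by rewrite binS bin1; lia.
rewrite tpowS IH /ctimes !natrD !natrM; ring: natH_qq.
Qed.

(** [tpow k] is k modulo q, and as q^2 = 0 the left argument of [cdot] matters only modulo q. *)
Lemma cdot_tpow k (c : H) : cdot (tpow k) c = cdot k%:R c.
Proof.
by rewrite tpowE /cdot natrD natrM; ring: natH_qq.
Qed.

Lemma val_unit : val (1 - q%:R : H) = (N + 1 - q)%N.
Proof.
have -> : 1 - q%:R = (N + 1 - q)%:R :> H.
  by rewrite natrB ?natrD ?natHN ?add0r //; have := leq_qN; lia.
by rewrite val_natH modn_small //; have := leq_qN; have := q_gt1; lia.
Qed.

Lemma val_cdot1 (b : H) : val (cdot 1 b) = ((val b * (N + 1 - q)) %% N)%N.
Proof.
rewrite -val_unit -val_natH natrM !natH_val.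
by rewrite /cdot mulr1 mulrC.
Qed.

(** * Cyclicity of (H, x) and the discrete logarithm *)

Hypothesis hodd : odd p \/ (p = 2%N /\ (nu, eta) <> (1%N, 2%N)).

(** 2 C(N, 2) = N (N - 1): for odd p the factor 2 is prime to N, for p = 2 it is taken from q. *)
Lemma tpowN : tpow N = 0.
Proof.
suff hC : (N %| 'C(N, 2) * q)%N.
  by rewrite tpowE natrD natHN add0r -natH_mod (eqP hC).
have h2 := double_bin2 N.
case: hodd => [op | [-> _]].
  have cop : coprime N 2 by rewrite coprimeXl // coprimen2.
  apply: dvdn_mulr; rewrite -(Gauss_dvdr _ cop) h2; exact: dvdn_mulr.
rewrite -(prednK hnu) expnS mulnCA mulnA double_bin2.
by rewrite -mulnA dvdn_mulr.
Qed.

(** If the powers with exponents l and l + d agree, N divides d + (C(d, 2) + l d) q. Except when N =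
    2, this is (after doubling for odd p) d times a number prime to p, so N divides d < N. *)
Lemma tpow_inj k l : (k < N)%N -> (l < N)%N -> tpow k = tpow l -> k = l.
Proof.
wlog le_lk : k l / (l <= k)%N.
  move=> W kN lN E; case: (leqP l k) => [h|/ltnW h]; first exact: W.
  by apply/esym; apply: W.
move=> kN _ /(congr1 val); rewrite !tpowE !val_natH.
rewrite -(subnKC le_lk); have : (k - l < N)%N by lia.
move: (k - l)%N => d dN /eqP; rewrite bin2_add.
rewrite eqn_mod_dvd; last by rewrite leq_add ?leq_addr // leq_mul2r; lia.
have -> : (l + d + ('C(l, 2) + 'C(d, 2) + l * d) * q - (l + 'C(l, 2) * q)
   = d + ('C(d, 2) + l * d) * q)%N by lia.
move=> hdvd; suff /eqP-> : d == 0%N by rewrite addn0.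
have [d0|d_gt0] := posnP d; first by [].
exfalso; suff /dvdn_leq : (N %| d)%N by lia.
have h2 := double_bin2 d.
case: hodd => [op | [p2 ne]].
  have cop : coprime N (2 + (d.-1 + 2 * l) * q).
    rewrite coprimeXl // prime_coprime // dvdn_addl ?dvdn_mull ?dvdn_exp //.
    by rewrite dvdn_prime2 //; apply/negP => /eqP E; rewrite E in op.
  rewrite -(Gauss_dvdl _ cop).
  rewrite (_ : d * _ = 2 * (d + ('C(d, 2) + l * d) * q))%N; last by lia.
  exact: dvdn_mull.
(* For nu > 1 the cofactor 1 + (d - 1 + 2 l) 2^(nu - 1) is odd. For nu = 1 the exclusion of (1, 2)
   leaves N = 2, settled by parity. *)
rewrite p2 in hdvd dN *; have [nu1|nu_gt1] := leqP nu 1.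
  have e1 : eta = 1%N.
    have ? : nu = 1%N by lia.
    have : eta <> 2%N by move=> ?; apply: ne; congr (_, _).
    by lia.
  have d1 : d = 1%N by move: dN; rewrite e1; lia.
  by move: hdvd; rewrite d1 e1 (_ : nu = 1%N) //; lia.
have cop : coprime (2 ^ eta) (1 + (d.-1 + 2 * l) * 2 ^ nu.-1).
  rewrite coprimeXl // coprime2n oddD oddM oddX.
  by case: (nu) nu_gt1 => [|[|n]] //= _; rewrite andbF.
rewrite -(Gauss_dvdl _ cop).
rewrite (_ : d * _ = d + ('C(d, 2) + l * d) * 2 ^ nu)%N //.
by rewrite -(prednK hnu) expnS /=; lia.
Qed.

Lemma tpow_mod k : tpow (k %% N) = tpow k.
Proof.
rewrite [in RHS](divn_eq k N) tpowD.
elim: (k %/ N)%N => [|m IH]; first by rewrite ctimes0.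
by rewrite mulSn tpowD tpowN ctimes0.
Qed.

(** N distinct powers exhaust the N elements of H, so [index] in [tlog] never returns its default
    N. *)
Lemma mem_tpow (a : H) : a \in mkseq tpow N.
Proof.
have us : uniq (mkseq tpow N) by apply/mkseq_uniqP => k l; exact: tpow_inj.
have [||_ ->] := @uniq_min_size _ (mkseq tpow N) (enum H) us.
- by move=> x _; rewrite mem_enum.
- by rewrite size_mkseq -cardE card_ord Zp_cast // N_gt1.
- by rewrite mem_enum.
Qed.

Lemma ltn_tlog (a : H) : (tlog a < N)%N.
Proof. by have := mem_tpow a; rewrite -index_mem size_mkseq. Qed.

Lemma tlogK (a : H) : tpow (tlog a) = a.
Proof.
by have := nth_index 0 (mem_tpow a); rewrite nth_mkseq // ltn_tlog.
Qed.

Lemma tpowK k : tlog (tpow k) = (k %% N)%N.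
Proof.
apply: tpow_inj; rewrite ?ltn_tlog ?ltn_mod ?N_gt0 //.
by rewrite tlogK tpow_mod.
Qed.

(** * Carries and the map f(1, .) *)

Variables (I : zmodType) (dia : diamond_action p nu eta I).
Local Notation A := (A dia).
Local Notation ftilde := (ftilde dia).
Local Notation fhat := (fhat dia).
Local Notation fcomp := (fcomp dia).

Lemma act_tpow k y : dia (tpow k) y = iter k A y.
Proof. by elim: k => [|k IH]; rewrite ?act0 // tpowS actM IH. Qed.

Lemma iterAN y : iter N A y = y.
Proof. by rewrite -act_tpow tpowN act0. Qed.

Lemma AMn n y : A (y *+ n) = A y *+ n.
Proof. exact: raddfMn. Qed.

(** Two representatives add up to less than 2 N, so the case distinction is a floor, and carries can
    be added. *)
Lemma alpha1E (g : I) (a b : H) :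
  alpha1 g a b = g *+ ((val a + val b) %/ N).
Proof.
rewrite /alpha1; case: leqP => [h|h]; last by rewrite divn_small ?mulr0n.
rewrite -(subnK h) divnDr // divnn N_gt0 divn_small ?mulr1n //.
by have := ltn_valH a; have := ltn_valH b; lia.
Qed.

(** Both ways of adding three representatives produce the total carry floor((a + b + c) / N). *)
Lemma alpha1_cocycle (g : I) (a b c : H) :
  alpha1 g b c - alpha1 g (a + b) c + alpha1 g a (b + c) - alpha1 g a b = 0.
Proof.
rewrite !alpha1E !val_addH [X in X - _ = _]addrAC -[LHS]addrA -opprD -!mulrnDr.
apply/eqP; rewrite subr_eq0; apply/eqP; congr (_ *+ _).
by rewrite addnC divnD_modr [(_ %% N + _)%N]addnC divnD_modr addnA addnC.
Qed.

Lemma GamE (g : I) b :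
  Gam dia g b = A g *+ ((b %% N).+1 %/ N)
    - g *+ ((b * (N + 1 - q) %% N + (N + 1 - q) %% N) %/ N).
Proof.
rewrite /Gam !alpha1E raddfMn !val_cdot1 (val_natH b) (val_natH 1).
by rewrite (modn_small N_gt1) mul1n addn1 modnMml.
Qed.

(** The sum telescopes: the two terms of [Gam] at b are the increments of the two floors from b to b
    + 1. *)
Lemma Gam_sum (g : I) h :
  \sum_(b < h) Gam dia g b =
    A g *+ (h %/ N) - g *+ ((h * (N + 1 - q)) %/ N).
Proof.
elim: h => [|h IH]; first by rewrite big_ord0 !div0n subrr.
rewrite big_ord_recr /= IH GamE -addrBAC -!mulrnDr.
congr (_ *+ _ - _ *+ _).
  by rewrite -add1n addnC divnD_modr.
rewrite addnC [(_ %% _ + _)%N]addnC divnD_modr.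
rewrite modn_small; last by have := leq_qN; have := q_gt1; lia.
by rewrite mulSn.
Qed.

Lemma fhatE f0 g h : fhat f0 g h =
  f0 *+ h + (A g *+ (h %/ N) - g *+ ((h * (N + 1 - q)) %/ N)).
Proof. by rewrite /fhat Gam_sum. Qed.

Lemma VE g : V dia g = g *+ (N + 1 - q) - A g.
Proof.
rewrite mulrnBr ?mulrnDr ?mulr1n; last by have := leq_qN; lia.
by rewrite /V [in RHS](addrAC _ g).
Qed.

(** Over one period the floors grow by 1 and by N + 1 - q, so their part changes by - V g, which N
    f0 = V g cancels. *)
Lemma fhatDN f0 g h : F1 dia (f0, g) = 0 -> fhat f0 g (h + N) = fhat f0 g h.
Proof.
move=> /eqP; rewrite subr_eq0 => /eqP /= E.
rewrite !fhatE mulrnDr E VE mulnDl (mulnC N) (addnC h N).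
rewrite (divnDl _ (dvdnn N)) divnn N_gt0 [(_ + _ * N)%N]addnC divnMDl ?N_gt0 //.
rewrite !mulrnDr mulr1n -addrA; congr (_ + _).
by rewrite addrBAC -(opprB (A g)) addKr.
Qed.

Lemma fhat_mod f0 g h : F1 dia (f0, g) = 0 -> fhat f0 g (h %% N) = fhat f0 g h.
Proof.
move=> E; rewrite [in RHS](divn_eq h N) addnC.
elim: (h %/ N)%N => [|m IH]; first by rewrite addn0.
by rewrite mulSnr addnA fhatDN.
Qed.

Lemma ftilde_nat f0 g k : F1 dia (f0, g) = 0 -> ftilde f0 g k%:R = fhat f0 g k.
Proof. by move=> E; rewrite /Defs.ftilde val_natH fhat_mod. Qed.

(** Periodicity replaces the reduced sum b + c by the sum of representatives; the linear part then
    cancels and the floors leave exactly the carries. *)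
Lemma ftildeD f0 g (b c : H) : F1 dia (f0, g) = 0 ->
  ftilde f0 g (b + c) - ftilde f0 g b - ftilde f0 g c =
  A (alpha1 g b c) - alpha1 g (cdot 1 b) (cdot 1 c).
Proof.
move=> E; rewrite /Defs.ftilde val_addH fhat_mod // !fhatE !alpha1E.
rewrite !val_cdot1 mulnDl (divnD_mod (_ * _)%N).
have small (x : H) : (val x %/ N = 0)%N by rewrite divn_small ?ltn_valH.
rewrite !small !mulr0n !sub0r AMn !mulrnDr -[LHS]addrA -opprD.
rewrite (addrACA (f0 *+ _) (- _)) -opprD addrBAC subrr add0r opprK.
rewrite -[LHS]addrA; congr (_ + _).
by rewrite opprD addrAC addNr add0r.
Qed.

(** * The crossed extension of f(1, .) along the powers of 1 *)

Definition fpow f0 g k (c : H) : I :=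
  \sum_(j < k) iter (k - 1 - j) A (ftilde f0 g (cdot j%:R c)).

Lemma iterA_zmod_morphism k : zmod_morphism (iter k A).
Proof. by elim: k => [|k IH] x y //; rewrite !iterS IH (raddfB A). Qed.

HB.instance Definition _ k :=
  GRing.isZmodMorphism.Build I I (iter k A) (iterA_zmod_morphism k).

Lemma iterAB k x y : iter k A (x - y) = iter k A x - iter k A y.
Proof. exact: raddfB. Qed.

Lemma iterAD k x y : iter k A (x + y) = iter k A x + iter k A y.
Proof. exact: raddfD. Qed.

Lemma iterAMn k n x : iter k A (x *+ n) = iter k A x *+ n.
Proof. exact: raddfMn. Qed.

Lemma fpow0 f0 g c : fpow f0 g 0 c = 0.
Proof. exact: big_ord0. Qed.

Lemma fpowS f0 g k c :
  fpow f0 g k.+1 c = A (fpow f0 g k c) + ftilde f0 g (cdot k%:R c).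
Proof.
rewrite /fpow big_ord_recr /= subn1 /= subnn; congr (_ + _).
rewrite (raddf_sum A); apply: eq_bigr => j _.
rewrite -iterS; congr (iter _ _ _).
by have := ltn_ord j; lia.
Qed.

Lemma fpowD f0 g k l c :
  fpow f0 g (k + l) c = iter l A (fpow f0 g k c) + fpow f0 g l (cdot k%:R c).
Proof.
elim: l => [|l IH]; first by rewrite addn0 fpow0 addr0.
by rewrite addnS !fpowS IH (raddfD A) -addrA natrD cdotDl.
Qed.

(** Telescopes along k: A applied to the term at (k . b, k . c) cancels against the one that
    [ftildeD] adds there. *)
Lemma fpow_beta f0 g k (b c : H) : F1 dia (f0, g) = 0 ->
  fpow f0 g k (b + c) - fpow f0 g k b - fpow f0 g k c =
  iter k A (alpha1 g b c) - alpha1 g (cdot k%:R b) (cdot k%:R c).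
Proof.
move=> E; elim: k => [|k IH]; first by rewrite !fpow0 !subr0 !cdot0l subrr.
have -> : k.+1%:R = k%:R + 1 :> H by rewrite mulrS addrC.
rewrite !fpowS !cdotDl cdotDr (addrBAC (A _)) (addrBAC (A _ - _)).
rewrite -!(raddfB A) IH (raddfB A).
by rewrite (ftildeD _ _ E) addrA subrK.
Qed.

(** The exponent of [fpow] is not reduced modulo N, which allows induction; when [fpow] vanishes at
    N, full periods contribute nothing and the reduction by [tlog] is harmless. *)
Lemma fcomp_tpow f0 g k c : fpow f0 g N c = 0 ->
  fcomp f0 g (tpow k) c = fpow f0 g k c.
Proof.
move=> fN; rewrite /Defs.fcomp tpowK -/(fpow _ _ _ _) [in RHS](divn_eq k N).
elim: (k %/ N)%N => // m IH.
by rewrite mulSn -addnA fpowD fN raddf0 add0r natHN cdot0l.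
Qed.

(** * Evaluation of P and Q, and the condition F2 *)

Lemma eval_end_widen (r : {poly int}) n y : (size r <= n)%N ->
  eval_end r A y = \sum_(j < n) iter j A y *~ r`_j.
Proof.
move=> h; rewrite /eval_end (big_ord_widen n (fun j => iter j A y *~ r`_j)) //.
rewrite big_mkcond; apply: eq_bigr => j _; case: ltnP => // /(nth_default 0) ->.
by rewrite mulr0z.
Qed.

Lemma eval_P y :
  eval_end (P p nu eta) A y = \sum_(j < N) iter j A y *+ (j * q + 1).
Proof.
rewrite (@eval_end_widen _ N); rewrite /P
  -(poly_def N (fun j => (j * q + 1)%N%:Z)).
  by apply: eq_bigr => j _; rewrite coef_poly ltn_ord pmulrn.
exact: size_poly.
Qed.

Lemma eval_Q y : eval_end (Q p nu eta) A y =
  \sum_(j < N) iter j A y *+ (j * p ^ (2 * nu - eta)) + y *+ q.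
Proof.
rewrite (@eval_end_widen _ N); rewrite /Q
  -(poly_def N (fun j => (j * p ^ (2 * nu - eta))%N%:Z)).
  rewrite -(prednK N_gt0) !big_ord_recl /= addrAC; congr (_ + _).
    by rewrite coefD coef_poly coefC /= mul0n mulr0n !add0r pmulrn.
  apply: eq_bigr => j _.
  by rewrite coefD coef_poly coefC /bump ltnS ltn_ord addr0 pmulrn.
rewrite (leq_trans (size_polyD _ _)) // geq_max size_poly.
by rewrite (leq_trans (size_polyC_leq1 _)) // N_gt0.
Qed.

(* Reindexing the sum [A (fpow f0 g N 1)] by j -> N - j turns the arguments of
   [ftilde] into 1 + p^nu i; the floors in [fhatE] then telescope, and what
   remains of them is the constant term p^nu of [Q]. *)
Lemma F2E f0 g : F1 dia (f0, g) = 0 -> F2 dia (f0, g) = A (fpow f0 g N 1).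
Proof.
move=> E; set r := (p ^ (2 * nu - eta))%N; set u := (N + 1 - q)%N.
have qN := leq_qN; have q1 := q_gt1.
have rN : (r * N = q * q)%N by rewrite -!expnD addnn -mul2n subnK.
pose T i := iter i A (fhat f0 g (i * q + 1)).
(* This is floor(((i - 1) q + 1) / N) + 1, written so that it makes sense, with value 0, at i = 0.
   Thus [D i.+1] is the A g term of [T i]. *)
pose d i := ((i * q + 1 + (N - q)) %/ N)%N.
have dS i : d i.+1 = ((i * q + 1) %/ N).+1.
  rewrite /d (_ : i.+1 * q + 1 + (N - q) = N + (i * q + 1))%N; last by lia.
  by rewrite divnDl ?dvdnn // divnn N_gt0 add1n.
(* As r N = q^2, (i q + 1) N + (i q + 1 + N - q) = (i r + 1) N + (i q + 1) u; divide by N. *)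
have dE i : (((i * q + 1) * u) %/ N + i * r + 1 = i * q + 1 + d i)%N.
  have -> : (i * q + 1 + d i =
      ((i * q + 1) * N + (i * q + 1 + (N - q))) %/ N)%N.
    by rewrite divnMDl ?N_gt0 //.
  have h : (i * r * N = i * (q * q))%N by rewrite -mulnA rN.
  have -> : ((i * q + 1) * N + (i * q + 1 + (N - q)) =
      (i * r + 1) * N + (i * q + 1) * u)%N.
    rewrite [in RHS]mulnDl h /u; move: qN; move: (p ^ eta)%N => n hn.
    by rewrite -(subnK hn) addnK; move: (n - q)%N => w; lia.
  by rewrite divnMDl ?N_gt0 // -addnA addnC.
pose D i := iter i A g *+ d i - iter i A g.
have TE i : T i = iter i A (f0 - g) *+ (i * q + 1) + iter i A g *+ (i * r)
    + (D i.+1 - D i).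
  rewrite /T fhatE -/u iterAB iterAD iterAB !iterAMn -iterSr /D dS mulrSr addrK.
  rewrite mulrnBl [RHS](AC (3*2) (1*(4*(2*(3*5))))) /=; congr (_ + (_ + _)).
  exact: mulrn_shift (dE i).
have -> : A (fpow f0 g N 1) = \sum_(i < N) T i.
  transitivity (\sum_(i < N) T i.+1).
    rewrite (raddf_sum A) (reindex_inj rev_ord_inj) /=; apply: eq_bigr => j _.
    have jN := ltn_ord j.
    rewrite (_ : N - 1 - (N - j.+1) = j)%N; last by lia.
    rewrite -iterS /T -(ftilde_nat _ E); congr (iter _ _ (ftilde _ _ _)).
    rewrite /cdot mulr1 natrB // natHN natrD natrM; ring.
  (* [T] has period N, since A^N = Id and [fhat] is periodic, so shifting the index by one preserves
     the sum. *)
  apply: (addrI (T 0)); rewrite -[LHS](big_ord_recl N (fun i => T i)).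
  rewrite big_ord_recr /= addrC; congr (_ + _).
  rewrite /T iterAN -!(ftilde_nat _ E) !natrD !natrM natHN.
  by rewrite !mul0r.
rewrite (eq_bigr _ (fun (i : 'I_N) _ => TE i)) 2!big_split /=.
rewrite telescope_sum_ord /D iterAN.
have small : ((1 + (N - q)) %/ N = 0)%N by rewrite divn_small; lia.
have -> : d N = q.
  by rewrite /d mulnC -addnA divnMDl ?N_gt0 // small addn0.
have -> : d 0%N = 0%N by [].
by rewrite /F2 eval_P eval_Q /= mulr0n sub0r opprK subrK addrA.
Qed.

(** For a cocycle this value is f(1, 0) = 0, which makes F1 = 0 necessary. *)
Lemma fhatN f0 g : fhat f0 g N = F1 dia (f0, g).
Proof.
rewrite fhatE /F1 /= VE divnn N_gt0 mulr1n mulKn ?N_gt0 //.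
by rewrite opprB.
Qed.

Lemma fhat1 f0 g : fhat f0 g 1 = f0.
Proof.
rewrite fhatE !divn_small ?N_gt1 //; last by have := leq_qN; have := q_gt1; lia.
by rewrite !mulr0n subrr addr0.
Qed.

Lemma A_eq0 y : A y = 0 -> y = 0.
Proof.
by move=> Ay; rewrite -[y]iterAN -(prednK N_gt0) iterSr Ay raddf0.
Qed.

(** At k = N the right side of [fpow_beta] cancels, since A^N = Id and [cdot N%:R] is the identity;
    an additive map on H is determined at 1. *)
Lemma fpow_eq0 f0 g c : F1 dia (f0, g) = 0 -> F2 dia (f0, g) = 0 ->
  fpow f0 g N c = 0.
Proof.
move=> E E2; rewrite (F2E E) in E2.
have f1 := A_eq0 E2.
have fD b d : fpow f0 g N (b + d) = fpow f0 g N b + fpow f0 g N d.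
  have := fpow_beta N b d E; rewrite natHN !cdot0l iterAN subrr => /eqP.
  by rewrite -addrA -opprD subr_eq0 => /eqP.
have f00 : fpow f0 g N 0 = 0.
  by apply: (addrI (fpow f0 g N 0)); rewrite -fD !addr0.
rewrite -(natH_val c); elim: (val c) => // n IH.
by rewrite mulrS fD f1 IH addr0.
Qed.

(** * F sends the kernel to cocycles *)

Lemma tpow1 : tpow 1 = 1.
Proof. by rewrite tpowE. Qed.

Lemma tlog0 : tlog 0 = 0%N.
Proof. by rewrite -[0]/(tpow 0) tpowK mod0n. Qed.

Lemma act_tlog (a : H) y : dia a y = iter (tlog a) A y.
Proof. by rewrite -act_tpow tlogK. Qed.

Lemma cdot_tlog (a c : H) : cdot (tlog a)%:R c = cdot a c.
Proof. by rewrite -cdot_tpow tlogK. Qed.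

Lemma F_cocycle f0 g : F1 dia (f0, g) = 0 -> F2 dia (f0, g) = 0 ->
  is_cocycle dia (F dia (f0, g)).
Proof.
move=> E E2.
have fE a c : fcomp f0 g a c = fpow f0 g (tlog a) c by [].
(* [tlog a + tlog b] may reach N; [fcomp_tpow] absorbs the overflow. *)
have fM a b c : fcomp f0 g (ctimes a b) c =
    dia b (fcomp f0 g a c) + fcomp f0 g b (cdot a c).
  rewrite -{1}(tlogK a) -{1}(tlogK b) -tpowD fcomp_tpow ?fpow_eq0 //.
  by rewrite fpowD -act_tlog cdot_tlog.
have fbeta a b c : fcomp f0 g a (b + c) - fcomp f0 g a b - fcomp f0 g a c =
    dia a (alpha1 g b c) - alpha1 g (cdot a b) (cdot a c).
  by rewrite !fE fpow_beta // -act_tlog !cdot_tlog.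
have alpha10 (a : H) : alpha1 g a 0 = 0 /\ alpha1 g 0 a = 0.
  by rewrite !alpha1E /= addn0 add0n divn_small ?ltn_valH.
split=> [a|a|a b|a b c|a b c|a b c]; rewrite !ffunE //=.
- split; last by rewrite fE tlog0 fpow0.
  have := fbeta a 0 0; rewrite addr0 cdot0r (alpha10 0).1 raddf0 subrr subr0.
  by rewrite sub0r => /eqP; rewrite oppr_eq0 => /eqP.
- by rewrite !alpha1E addnC.
- exact: alpha1_cocycle.
- by rewrite -[a + b]ctimes_cdot fM.
Qed.

(** * Cocycles with first component alpha1(gamma) *)

Section CocycleDetermined.

Variables (z : cochain p eta I) (g : I).
Hypothesis hz : is_cocycle dia z.

(** The cocycle identity at (a, n, 1) expresses beta(a, n + 1) through beta(a, n) and values at (.,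
    1). *)
Lemma cocycle_beta_alpha1 :
  (forall b, z.1 (b, 1) = alpha1 g b 1) ->
  forall a b, z.1 (a, b) = alpha1 g a b.
Proof.
move=> h a b; rewrite -(natH_val b).
elim: (val b) => [|n IH].
  by rewrite (cocycle_beta0 hz a).1 alpha1E /= addn0 divn_small ?ltn_valH.
rewrite mulrS addrC.
have := cocycle_beta hz a n%:R 1; rewrite -(alpha1_cocycle g a n%:R 1).
by rewrite !h IH => /addIr /addrI.
Qed.

Hypothesis hz1 : forall a b, z.1 (a, b) = alpha1 g a b.
Let f0 := z.2 (1, 1).

(** The second condition at (1, k, 1) has right-hand side [Gam dia g k], so f(1, .) obeys the
    recursion of [fhat]. *)
Lemma cocycle_fhat k : z.2 (1, k%:R) = fhat f0 g k.
Proof.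
elim: k => [|k IH].
  by rewrite (cocycle_f0 hz 1).1 /Defs.fhat big_ord0 addr0 mulr0n.
rewrite mulrS addrC.
have := cocycle_beta_f hz 1 k%:R 1; rewrite !hz1 -/f0 -[RHS]/(Gam dia g k).
rewrite -addrA -opprD => /(canRL (subrK _)) ->.
rewrite IH /Defs.fhat big_ord_recr /= mulrSr.
by rewrite [RHS](AC (2*2) (4*((1*3)*2))).
Qed.

Lemma cocycle_F1 : F1 dia (f0, g) = 0.
Proof. by rewrite -fhatN -cocycle_fhat natHN (cocycle_f0 hz 1).1. Qed.

Lemma cocycle_times a b c :
  z.2 (ctimes a b, c) = dia b (z.2 (a, c)) + z.2 (b, cdot a c).
Proof.
(* [cdot a] has inverse [cdot (- a)], so every b has the form a . b' required by the third
   condition. *)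
have -> : b = cdot a (cdot (- a) b) by rewrite -cdotDl addNr cdot0l.
by rewrite ctimes_cdot (cocycle_f hz).
Qed.

Lemma cocycle_fpow k c : z.2 (tpow k, c) = fpow f0 g k c.
Proof.
elim: k => [|k IH]; first by rewrite fpow0 (cocycle_f0 hz c).2.
rewrite tpowS ctimesC cocycle_times IH fpowS cdot_tpow; congr (_ + _).
by rewrite -(natH_val (cdot _ _)) cocycle_fhat natH_val.
Qed.

(** The N-th power of 1 is 0, so [fpow] at N computes f(0, 1) = 0, whose image under A is F2 by
    [F2E]. *)
Lemma cocycle_F2 : F2 dia (f0, g) = 0.
Proof.
rewrite (F2E cocycle_F1) -cocycle_fpow tpowN (cocycle_f0 hz 1).2.
exact: raddf0.
Qed.

Lemma cocycleE : z = F dia (f0, g).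
Proof.
rewrite [LHS]surjective_pairing; congr (_, _); apply/ffunP => -[a b].
  by rewrite ffunE hz1.
by rewrite ffunE -[LHS]/(z.2 (a, b)) -{1}(tlogK a) cocycle_fpow.
Qed.

End CocycleDetermined.

(** * Coboundaries and the image of G *)

Definition cob (t : H -> I) : cochain p eta I :=
  ([ffun u => t u.1 - t (u.1 + u.2) + t u.2],
   [ffun u => t (cdot u.1 u.2) - dia u.1 (t u.2)]).

Lemma cob1 t a b : (cob t).1 (a, b) = t a - t (a + b) + t b.
Proof. by rewrite ffunE. Qed.

Lemma cob2 t a b : (cob t).2 (a, b) = t (cdot a b) - dia a (t b).
Proof. by rewrite ffunE. Qed.

Lemma cob_cocycle t : t 0 = 0 -> is_cocycle dia (cob t).
Proof.
move=> t0; split=> [a|a|a b|a b c|a b c|a b c]; rewrite !ffunE /=.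
- by rewrite addr0 add0r t0 subrr sub0r addr0 addNr.
- by rewrite cdot0r cdot0l t0 raddf0 act0 !subrr.
- by rewrite addrAC [b + a]addrC [RHS]addrAC [t a + t b]addrC.
- rewrite !opprD !opprK (addrA a b c).
  rewrite [LHS](AC (3*3*3*3) ((1*12)*(9*2)*(3*6)*(11*4)*(5*8)*(7*10))) /=.
  by rewrite !subrr !addr0.
- rewrite cdotDr (raddfD (dia a)) (raddfB (dia a)) !opprD !opprK.
  by rewrite [LHS](AC (2*2*2) ((4*2*6)*(3*1*5))).
- rewrite -cdot_times ctimes_cdot -{2}(ctimes_cdot a b) ctimesC actM.
  rewrite (raddfB (dia (cdot a b))).
  by rewrite [RHS](AC (2*2) ((3*2)*(1*4))) /= subrr addr0.
Qed.

Lemma cob_mul y : exists t,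
  [/\ t 0 = 0,
    forall a b, (cob t).1 (a, b) = alpha1 (y *+ N) a b
    & (cob t).2 (1, 1) = V dia y].
Proof.
exists (fun h => y *+ val h); split=> // [a b|]; rewrite ?cob1 ?cob2.
  rewrite addrAC -mulrnDr alpha1E val_addH -mulrnA mulnC.
  by rewrite {1}(divn_eq (val a + val b) N) mulrnDr addrK.
rewrite val_cdot1 (val_natH 1) (modn_small N_gt1) mul1n modn_small.
  by rewrite VE.
by have := leq_qN; have := q_gt1; lia.
Qed.

(** Needs no computation with P and Q: (V y, N y) are the parameters of the coboundary in [cob_mul],
    and parameters of cocycles satisfy both equations. *)
Lemma G_ker y : G dia y \in ker_pred dia.
Proof.
have [t [t0 t1 t2]] := cob_mul y; have ct := cob_cocycle t0.
apply/andP; rewrite /G -t2; split; apply/eqP.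
  exact: cocycle_F1 ct t1.
exact: cocycle_F2 ct t1.
Qed.

Lemma F_G y : exists2 t, t 0 = 0 & F dia (G dia y) = cob t.
Proof.
have [t [t0 t1 t2]] := cob_mul y; exists t => //.
by rewrite /G -t2 -(cocycleE (cob_cocycle t0) t1).
Qed.

(** Without a carry beta vanishes, so t(n) = n t(1) for n < N; the carry at (N - 1, 1) then gives g
    = N t(1), and the second component at (1, 1) gives f0 = V (t 1). *)
Lemma F_cob f0 g t : t 0 = 0 -> F dia (f0, g) = cob t ->
  (f0, g) = G dia (t 1).
Proof.
move=> t0 E.
have E1 a b : alpha1 g a b = t a - t (a + b) + t b.
  by have /ffunP/(_ (a, b)) := congr1 fst E; rewrite !ffunE.
have tn n : (n < N)%N -> t n%:R = t 1 *+ n.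
  elim: n => [|n IH] h; first by rewrite mulr0n.
  have := E1 n%:R 1; rewrite alpha1E (val_natH n) (val_natH 1).
  rewrite !modn_small ?N_gt1 ?(ltnW h) // addn1 divn_small // mulr0n.
  rewrite addrAC natr1 => /esym/eqP; rewrite subr_eq0 => /eqP <-.
  by rewrite IH 1?ltnW // mulrSr.
have gE : g = t 1 *+ N.
  have := E1 N.-1%:R 1; rewrite natr1 prednK ?N_gt0 // natHN t0 subr0.
  rewrite tn ?prednK ?N_gt0 // -mulrSr prednK ?N_gt0 // => <-.
  rewrite alpha1E (val_natH N.-1) (val_natH 1).
  rewrite !modn_small ?N_gt1 ?prednK ?N_gt0 //.
  by rewrite addn1 prednK ?N_gt0 // divnn N_gt0.
have f0E : f0 = V dia (t 1).
  have := congr1 snd E => /ffunP/(_ (1, 1)); rewrite !ffunE.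
  rewrite /fcomp -[X in tlog X]tpow1 tpowK (modn_small N_gt1) big_ord1.
  rewrite [iter _ _ _]/(ftilde f0 g (cdot 0 1)) cdot0l.
  rewrite /Defs.ftilde (val_natH 1).
  rewrite (modn_small N_gt1) fhat1 => ->.
  rewrite [LHS]/(t (cdot 1 1) - A (t 1)) VE -(natH_val (cdot 1 1)) val_cdot1.
  rewrite (val_natH 1) (modn_small N_gt1) mul1n.
  by rewrite natH_mod tn //; have := leq_qN; have := q_gt1; lia.
by rewrite /G -f0E -gE.
Qed.

(* [t] is chosen so that w (b, 1) vanishes for b <> -1, where w is the first
   component of z - cob t; a 2-cocycle is determined by its values at (b, 1). *)
Lemma cocycle_reduce z : is_cocycle dia z -> exists g t,
  t 0 = 0 /\ forall a b, (z - cob t).1 (a, b) = alpha1 g a b.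
Proof.
move=> hz.
pose t (h : H) := - \sum_(b < val h) z.1 (b%:R, 1).
have t0 : t 0 = 0 by rewrite /t big_ord0 oppr0.
set w := z - cob t.
have hw : is_cocycle dia w.
  apply/asboolP/(cocycle_zmod_closed dia).2; apply/asboolP => //.
  exact: cob_cocycle.
(* gamma is the one remaining value, at the only b where adding 1 carries. *)
exists (w.1 (N.-1%:R, 1)), t; split=> //.
apply: (cocycle_beta_alpha1 hw) => b.
have t1 : t 1 = 0.
  rewrite /t (val_natH 1) (modn_small N_gt1) big_ord1.
  by rewrite (cocycle_beta0 hz 1).2 oppr0.
rewrite alpha1E (val_natH 1) (modn_small N_gt1) addn1.
have [lt|ge] := ltnP (val b).+1 N; last first.
  have e : (val b).+1 = N by apply/eqP; rewrite eqn_leq ge ltn_valH.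
  have bE : b = N.-1%:R by rewrite -(congr1 predn e) natH_val.
  by rewrite -bE e divnn N_gt0.
have tS : t (b + 1) = t b - z.1 (b, 1).
  rewrite /t val_addH (val_natH 1) (modn_small N_gt1) addn1 modn_small //.
  by rewrite big_ord_recr /= opprD natH_val.
rewrite divn_small // mulr0n /w ffunE [(- cob t).1 _]ffunE cob1.
by rewrite tS t1 opprD opprK addrA subrr add0r addr0 subrr.
Qed.

Lemma F_zmod_morphism : zmod_morphism (F dia).
Proof.
move=> [f0 g] [f1 h]; congr (_, _); apply/ffunP => -[a b]; rewrite !ffunE /=.
  by rewrite !alpha1E mulrnBl.
rewrite /Defs.fcomp -sumrB; apply: eq_bigr => j _.
rewrite -iterAB /Defs.ftilde !fhatE !mulrnBl (raddfB A) mulrnBl.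
by congr (iter _ _ _); rewrite (subrBAC (A g *+ _)) -addrBAC.
Qed.

End CycleSet.

(** * The induced isomorphism of quotients *)

Section Isomorphism.

Variables (p nu eta : nat) (I : zmodType) (dia : diamond_action p nu eta I).
Hypotheses (hp : prime p) (hnu : (0 < nu)%N).
Hypotheses (hnueta : (nu <= eta)%N) (heta : (eta <= 2 * nu)%N).
Hypothesis hodd : odd p \/ (p = 2%N /\ (nu, eta) <> (1%N, 2%N)).

Lemma F_cocycle_pred (x : kernel dia) : F dia (val x) \in cocycle_pred dia.
Proof.
case: x => -[f0 g] /= /andP [/eqP h1 /eqP h2].
by apply/asboolP; apply: F_cocycle.
Qed.

Definition Fbar (x : kernel dia) : cocycle dia := Cocycle (F_cocycle_pred x).

Lemma FbarB x y : Fbar (x - y) = Fbar x - Fbar y.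
Proof.
apply: val_inj; rewrite [RHS](raddfB val) /= -F_zmod_morphism //.
Qed.

Lemma is_coboundaryP (z : cocycle dia) :
  is_coboundary z <-> exists2 t, t 0 = 0 & val z = cob dia t.
Proof.
split=> [[t [t0 t1 t2]] | [t t0 E]]; exists t => //.
  rewrite [LHS]surjective_pairing; congr (_, _); apply/ffunP => -[a b].
    by rewrite t1 ffunE.
  by rewrite t2 ffunE.
by split=> // a b; rewrite E ?cob1 ?cob2.
Qed.

(** From right to left this makes the induced map well defined, from left to right injective. *)
Lemma Fbar_coboundary x :
  (Fbar x \in @coboundary_pred _ _ _ _ dia) = (x \in @im_pred _ _ _ _ dia).
Proof.
apply/asboolP/asboolP => [/is_coboundaryP [t t0 E] | [y E]].
  exists (t 1); move: E; rewrite /=; case: (val x) => f0 g.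
  exact: F_cob.
apply/is_coboundaryP; have [t t0 h] := F_G hp hnu hnueta heta hodd dia y.
by exists t => //; rewrite /= -h -E.
Qed.

Lemma Fbar_surj (z : cocycle dia) :
  exists x, z - Fbar x \in @coboundary_pred _ _ _ _ dia.
Proof.
have hz : is_cocycle dia (val z) by apply/asboolP; exact: cocycleP.
have [g [t [t0 h]]] := cocycle_reduce hp hnu hnueta heta hodd hz.
set w := val z - cob dia t in h.
have hw : is_cocycle dia w.
  apply/asboolP/(cocycle_zmod_closed dia).2; apply/asboolP => //.
  exact: cob_cocycle.
have kw : (w.2 (1, 1), g) \in ker_pred dia.
  apply/andP; split; apply/eqP; last exact: cocycle_F2 hw h.
  exact: cocycle_F1 hw h.
exists (Kernel kw); apply/asboolP/is_coboundaryP; exists t => //.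
rewrite (raddfB val) /= -(cocycleE hp hnu hnueta heta hodd hw h).
by rewrite subKr.
Qed.

End Isomorphism.

Theorem corollary3p29 (p nu eta : nat) (I : zmodType)
    (dia : diamond_action p nu eta I) (hp : prime p)
    (hnu : (0 < nu)%N) (hnueta : (nu <= eta)%N) (heta : (eta <= 2 * nu)%N)
    (hodd : odd p \/ (p = 2%N /\ (nu, eta) <> (1%N, 2%N))) :
  (forall y : I, G dia y \in ker_pred dia) /\
  exists Fbar : kernel dia -> cocycle dia,
    (forall x : kernel dia, val (Fbar x) = F dia (val x)) /\
    exists phi : {additive ker_mod_im dia -> H2 dia},
      bijective phi /\
      forall x : kernel dia, phi (\pi_(ker_mod_im dia) x) = \pi_(H2 dia) (Fbar x).
Proof.
split; first exact: G_ker.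
pose F' := @Fbar _ _ _ _ dia hp hnu hnueta heta hodd.
have F'B x y : F' (x - y) = F' x - F' y by exact: FbarB.
(* Defined on chosen representatives; [phi_pi] shows independence of the choice. *)
pose phi (c : ker_mod_im dia) : H2 dia := \pi_(H2 dia) (F' (repr c)).
have phi_pi x : phi (\pi_(ker_mod_im dia) x) = \pi_(H2 dia) (F' x).
  apply/eqP; rewrite /phi -Quotient.idealrBE -FbarB Fbar_coboundary.
  by rewrite Quotient.idealrBE reprK.
have phiB : zmod_morphism phi.
  move=> c d; rewrite -(reprK c) -(reprK d) -raddfB !phi_pi F'B.
  exact: raddfB.
pose phiA : {additive ker_mod_im dia -> H2 dia} :=
  HB.pack phi (GRing.isZmodMorphism.Build _ _ phi phiB).
exists F'; split=> //; exists phiA; split=> //.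
have phi_surj d : exists c, phi c == d.
  have [x hx] := Fbar_surj hp hnu hnueta heta hodd (repr d).
  exists (\pi x); rewrite phi_pi -(reprK d) eq_sym -Quotient.idealrBE.
  exact: hx.
have phi_inj : injective phi.
  move=> c d; rewrite -(reprK c) -(reprK d) !phi_pi => /eqP.
  by rewrite -Quotient.idealrBE -FbarB Fbar_coboundary Quotient.idealrBE => /eqP.
(* The inverse picks a preimage; by injectivity it is also a left inverse. *)
exists (fun d => xchoose (phi_surj d)) => [c|d]; last first.
  exact/eqP/(xchooseP (phi_surj d)).
exact/phi_inj/eqP/(xchooseP (phi_surj (phi c))).
Qed.
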